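(* Let $-\infty<a<b<\infty$ and let $n\ge1$ be an integer. The Poincaré quadrature of $H^1(a,b)$ with $n$ nodes corresponds to the midpoint (rectangle) quadrature rule $$\int_a^b f(x)\,dx\;\approx\;\frac{b-a}{n}\sum_{i=1}^n f\!\left(a+\left(i-\tfrac12\right)\frac{b-a}{n}\right).$$ Thus its weights are all equal to $1/n$, and its nodes are $x_i=a+\left(i-\frac12\right)\frac{b-a}{n}$, $i=1,\dots,n$: they are evenly spaced on $[a,b]$ and located at the middle of each interval $\left[a+(i-1)\frac{b-a}{n},\,a+i\frac{b-a}{n}\right]$. This quadrature is exact for all $\varphi_m$ with $m\le 2n-1$. Furthermore it is also exact for all $\varphi_m$ such that $m$ is not a multiple of $2n$, and for polynomials of order $1$ (degree at most one).
   Context: Here $\mu$ is the uniform probability distribution on $[a,b]$, $d\mu=dx/(b-a)$, and $H^1(a,b)=H^1(\mu)$. The Poincaré basis of $\mu$ is given by the $L^2(\mu)$-normalized eigenfunctions of $\varphi''=-\lambda\varphi$ on $[a,b]$ with $\varphi'(a)=\varphi'(b)=0$, ordered by increasing eigenvalue: $\varphi_0=1$ and $\varphi_m(x)=\sqrt2\cos\left(m\pi\frac{x-a}{b-a}\right)$ for $m\ge1$. A quadrature with nodes $x_i\in[a,b]$ and weights $w_i$ ($i=1,\dots,n$) is exact for $f$ if $\int_a^b f\,d\mu=\sum_{i=1}^n w_if(x_i)$. The Poincaré quadrature with $n$ nodes is the unique quadrature with $n$ nodes in $[a,b]$ and positive weights that is exact for $\varphi_0,\dots,\varphi_{2n-1}$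 (existence and uniqueness are known because the Poincaré basis is, up to signs, a Tchebytchev system). *)

(* Defs.v *)
From HB Require Import structures.
From mathcomp Require Import all_boot all_order all_algebra all_fingroup.
From mathcomp Require Import all_classical all_reals all_analysis.

Set Implicit Arguments.
Unset Strict Implicit.
Unset Printing Implicit Defensive.

Import Order.TTheory GRing.Theory Num.Theory.
Import numFieldNormedType.Exports.

Local Open Scope classical_set_scope.
Local Open Scope ring_scope.

(* f is a nonzero solution on [a, b] of f'' = - lam f, f'(a) = f'(b) = 0.
   Only the restriction of f to [a, b] matters: df is the derivative of f on
   ]a, b[, extended by continuity to the endpoints, where it is therefore the
   one-sided derivative of f. *)
Definition neumann_eigenfunction (R : realType) (a b lam : R) (f : R -> R) :=
  (exists2 x, x \in `[a, b] & f x != 0) /\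
  exists df : R -> R,
    [/\ {within `[a, b], continuous f},
        {within `[a, b], continuous df},
        forall x, x \in `]a, b[ ->
          is_derive x 1 f (df x) /\ is_derive x 1 df (- lam * f x),
        df a = 0
      & df b = 0].

(* The increasing enumeration is strict and without repetition because the
   eigenvalues of this Sturm-Liouville problem are simple; in particular each
   phi m is determined on [a, b] up to its sign. *)
Definition poincare_basis (R : realType) (a b : R) (ab : a < b)
    (phi : nat -> R -> R) :=
  exists lam : nat -> R,
    [/\ forall i j, (i < j)%N -> lam i < lam j,
        forall m, neumann_eigenfunction a b (lam m) (phi m),
        forall l f, neumann_eigenfunction a b l f -> exists m, l = lam m
      & forall m,
          (\int[uniform_prob ab]_(x in `[a, b]) (phi m x ^+ 2)%:E = 1)%E].

Definition cosine_basis (R : realType) (a b : R) (m : nat) (x : R) : R :=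
  if m == 0%N then 1
  else Num.sqrt 2 * cos (m%:R * pi * ((x - a) / (b - a))).

Definition quad (R : realType) (n : nat) (x w : 'I_n -> R) (f : R -> R) : R :=
  \sum_(i < n) w i * f (x i).

Definition quad_exact (R : realType) (a b : R) (ab : a < b) (n : nat)
    (x w : 'I_n -> R) (f : R -> R) :=
  (\int[uniform_prob ab]_(t in `[a, b]) (f t)%:E = (quad x w f)%:E)%E.

(* The nodes are distinct but not assumed to be listed in any order, so a
   quadrature is meant up to a renumbering of its pairs (x i, w i). *)
Definition poincare_quadrature (R : realType) (a b : R) (ab : a < b)
    (phi : nat -> R -> R) (n : nat) (x w : 'I_n -> R) :=
  [/\ injective x,
      forall i, x i \in `[a, b],
      forall i, 0 < w i
    & forall m, (m <= (2 * n).-1)%N -> quad_exact ab x w (phi m)].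

(* Indices start at 0: this is the node numbered i + 1 in the usual 1-based
   numbering, namely a + ((i + 1) - 1/2) (b - a) / n. *)
Definition midpoint_node (R : realType) (a b : R) (n : nat) (i : 'I_n) : R :=
  a + (i.+1%:R - 2^-1) * ((b - a) / n%:R).

Definition midpoint_rule (R : realType) (a b : R) (n : nat) (f : R -> R) : R :=
  (b - a) / n%:R * \sum_(i < n) f (midpoint_node a b i).

(* Main.v *)
Require Import Defs.
From HB Require Import structures.
From mathcomp Require Import all_boot all_order all_algebra all_fingroup.
From mathcomp Require Import all_classical all_reals all_analysis.
From mathcomp Require Import measurable_realfun.
From mathcomp Require Import ring lra.

Set Implicit Arguments.
Unset Strict Implicit.
Unset Printing Implicit Defensive.

Import Order.TTheory GRing.Theory Num.Theory.
Import numFieldNormedType.Exports.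

Local Open Scope classical_set_scope.
Local Open Scope ring_scope.

(** The proof separates into the identification of the basis, the exactness
of the midpoint rule, and its uniqueness.

The basis.  For lam <= 0 an eigenfunction f is constant and lam = 0, because
f f' is nondecreasing, its derivative being f'^2 - lam f^2 >= 0, and vanishes
at both endpoints [neumann_eigenvalue_le0].  For lam = w^2 > 0 the two
quantities obtained by rotating the vector (w f, f') backwards by the angle
w (x - a) are constant, so that f is a multiple of cos (w (x - a)), and the
condition at b forces sin (w (b - a)) = 0 [neumann_eigenvalue_gt0].  Hence the
eigenvalues are the squares of m pi / (b - a), and any strictly increasing
enumeration of all of them is the obvious one.  Every Poincare basis therefore
agrees on [a, b] with the cosine basis up to nonzero factors
[poincare_basis_cos], and such factors do not affect exactness.

Exactness.  In the variable t = (x - a) / (b - a) the integral of cos (m pi t)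
vanishes for m > 0, while its sum over the midpoints, once multiplied by
2 sin (m pi / (2 n)), telescopes to sin (m pi) = 0; this sine is nonzero as
soon as 2 n does not divide m [sum_cos_midpoints].

Uniqueness.  Since cos (m t) is a polynomial of degree m in cos t, a quadrature
exact for the first 2 n basis functions has, in the variable y = cos (pi t),
the same first 2 n power moments as the midpoint rule [cos_moments_pow].  It is
a Gauss quadrature, and these are determined by their moments
[gauss_unique]: if q is the monic polynomial vanishing at the nodes of one
rule, both rules send q p to 0 for every p of degree less than n, and taking for
p the Lagrange polynomials of the other rule shows that q vanishes at its nodes
too. *)

(** * Trigonometric sums and zeros of the sine *)

Lemma sin_nat_pi (R : realType) (m : nat) : sin (m%:R * pi) = 0 :> R.
Proof.
elim: m => [|m IH]; first by rewrite mul0r sin0.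
by rewrite -natr1 mulrDl mul1r sinDpi IH oppr0.
Qed.

Lemma sin_eq0_nat (R : realType) (t : R) : 0 <= t -> sin t = 0 ->
  exists m : nat, t = m%:R * pi.
Proof.
move=> t0 st.
have pi0 : (pi : R) > 0 := pi_gt0 R.
have /andP[lo hi] := truncn_itv (divr_ge0 t0 (ltW pi0)).
set m := Num.truncn _ in lo hi; exists m.
rewrite ler_pdivlMr// in lo; rewrite ltr_pdivrMr// -natr1 mulrDl mul1r in hi.
have sr : sin (t - m%:R * pi) = 0.
  by rewrite sinB st sin_nat_pi mul0r mulr0 subrr.
apply/eqP; rewrite eq_le lo andbT leNgt; apply/negP => lt.
have := @sin_gt0_pi R (t - m%:R * pi).
by rewrite sr ltxx subr_gt0 lt ltrBlDl hi => /(_ isT).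
Qed.

(** With s = m pi / (2 n), the identity
2 sin s cos u = sin (u + s) - sin (u - s) makes the sum telescope; sin s is
nonzero because m is not a multiple of 2 n. *)
Lemma sum_cos_midpoints (R : realType) (n m : nat) : (0 < n)%N ->
  ~~ (2 * n %| m)%N ->
  \sum_(i < n) cos (m%:R * pi * ((i.+1%:R - 2^-1) / n%:R)) = 0 :> R.
Proof.
move=> n0 ndvd; pose s : R := m%:R * pi / (2 * n%:R).
have n0' : n%:R != 0 :> R by rewrite pnatr_eq0 -lt0n.
have s0 : sin s != 0.
  apply/negP => /eqP/sin_eq0_nat[|k].
    by rewrite /s !mulr_ge0 ?invr_ge0 ?mulr_ge0 ?pi_ge0// ler0n.
  move=> sE; have pi0 : (pi : R) != 0 by rewrite gt_eqF ?pi_gt0.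
  have : pi * m%:R = pi * (2 * n * k)%:R :> R.
    have -> : pi * m%:R = s * (2 * n%:R) by rewrite /s; field.
    by rewrite sE !natrM; ring.
  move=> /(mulfI pi0)/eqP; rewrite eqr_nat => /eqP mE.
  by move/negP: ndvd; apply; rewrite mE dvdn_mulr.
apply: (mulfI (mulf_neq0 (_ : 2 != 0 :> R) s0)); first by rewrite pnatr_eq0.
rewrite mulr0 mulr_sumr.
pose g i : R := sin (m%:R * pi * (i%:R / n%:R)).
rewrite (eq_bigr (fun i : 'I_n => g i.+1 - g i)) => [|i _].
  rewrite -(big_mkord xpredT (fun i => g i.+1 - g i)) telescope_sumr//.
  by rewrite /g divff// mulr1 mul0r mulr0 sin0 sin_nat_pi subrr.
rewrite /g.
have -> : m%:R * pi * (i.+1%:R / n%:R) =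
  m%:R * pi * ((i.+1%:R - 2^-1) / n%:R) + s :> R by rewrite /s; field.
have -> : m%:R * pi * (i%:R / n%:R) =
  m%:R * pi * ((i.+1%:R - 2^-1) / n%:R) - s :> R by rewrite /s -natr1; field.
by rewrite sinD sinB; ring.
Qed.

(** * Quadratures determined by their moments *)

Lemma moments_poly (F : fieldType) (n N : nat) (x w y v : 'I_n -> F) :
  (forall k, (k < N)%N ->
     \sum_(i < n) w i * x i ^+ k = \sum_(i < n) v i * y i ^+ k) ->
  forall p : {poly F}, (size p <= N)%N ->
    \sum_(i < n) w i * p.[x i] = \sum_(i < n) v i * p.[y i].
Proof.
move=> eqm p pN.
have mom (z u : 'I_n -> F) : \sum_(i < n) u i * p.[z i] =
    \sum_(k < N) p`_k * \sum_(i < n) u i * z i ^+ k.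
  under eq_bigr do rewrite (horner_coef_wide _ pN) mulr_sumr.
  rewrite exchange_big/=; apply: eq_bigr => k _; rewrite mulr_sumr.
  by apply: eq_bigr => i _; rewrite mulrCA.
by rewrite !mom; apply: eq_bigr => k _; rewrite eqm.
Qed.

Lemma size_node_poly (F : fieldType) (n : nat) (P : pred 'I_n) (y : 'I_n -> F) :
  (size (\prod_(i | P i) ('X - (y i)%:P))%R <= #|P|.+1)%N.
Proof.
apply: leq_trans (size_poly_prod_leq _ _) _.
rewrite (eq_bigr (fun=> 2%N)); last by move=> i _; rewrite size_XsubC.
by rewrite sum_nat_const muln2 -addnn -addSn addnK.
Qed.

Lemma horner_node_poly (F : fieldType) (n : nat) (P : pred 'I_n)
    (y : 'I_n -> F) (t : F) :
  (\prod_(i | P i) ('X - (y i)%:P)).[t] = \prod_(i | P i) (t - y i).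
Proof. by rewrite horner_prod; apply: eq_bigr => i _; rewrite hornerXsubC. Qed.

(** The Lagrange factor kills every term of the sum except the one at y j. *)
Lemma sum_node_poly (F : fieldType) (n : nat) (v y : 'I_n -> F) (r : {poly F})
    (j : 'I_n) :
  \sum_(i < n) v i * (r * \prod_(k | k != j) ('X - (y k)%:P)).[y i] =
  v j * (r.[y j] * \prod_(k | k != j) (y j - y k)).
Proof.
apply: etrans (bigD1 j erefl) _ => /=.
rewrite [X in _ + X]big1 ?addr0 ?hornerM ?horner_node_poly// => i ij.
by rewrite hornerM horner_node_poly (bigD1 i)//= subrr mul0r !mulr0.
Qed.

(** If q is the nodal polynomial of (x, w), then q times the j-th Lagrange
factor of y has degree 2 n - 1; the rule (x, w) sends it to 0 and the rule (y, v) to a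
nonzero multiple of q (y j).  So each y j is one of the x i, and the Lagrange
factors of x then compare the weights. *)
Lemma gauss_unique (F : fieldType) (n : nat) (x w y v : 'I_n -> F) :
  injective x -> injective y -> (forall i, v i != 0) ->
  (forall k, (k < 2 * n)%N ->
     \sum_(i < n) w i * x i ^+ k = \sum_(i < n) v i * y i ^+ k) ->
  exists s : {perm 'I_n}, forall i, x (s i) = y i /\ w (s i) = v i.
Proof.
move=> xI yI v0 /moments_poly eqm.
have lag0 (z : 'I_n -> F) (zI : injective z) j :
    \prod_(k | k != j) (z j - z k) != 0.
  apply/prodf_neq0 => k kj; rewrite subr_eq0; apply: contra kj => /eqP/zI ->.
  exact: eqxx.
have szlag (z : 'I_n -> F) j :
    (size (\prod_(k | k != j) ('X - (z k)%:P))%R <= n)%N.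
  apply: leq_trans (size_node_poly _ _) _.
  by rewrite cardC1 card_ord; case: n j {x w y v xI yI v0 eqm lag0 z} => [[]|].
(* Each node of the second rule is a node of the first. *)
have yx j : exists i, x i == y j.
  pose q := \prod_(i < n) ('X - (x i)%:P).
  have szq : (size q <= n.+1)%N.
    by apply: leq_trans (size_node_poly _ _) _; rewrite card_ord.
  have /eqm : (size (q * \prod_(k | k != j) ('X - (y k)%:P))%R <= 2 * n)%N.
    apply: leq_trans (size_polyMleq _ _) _.
    have := leq_add szq (szlag y j); rewrite addSn addnn -mul2n.
    by case: (_ + _)%N.
  rewrite sum_node_poly big1 => [/esym/eqP|i _]; last first.
    by rewrite hornerM horner_node_poly (bigD1 i)//= subrr !mul0r mulr0.
  rewrite !mulf_eq0 (negbTE (v0 j)) (negbTE (lag0 _ yI j)) orbF/=.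
  rewrite horner_node_poly => /prodf_eq0[i _].
  by rewrite subr_eq0 eq_sym; exists i.
pose s0 j := xchoose (yx j).
have s0P j : x (s0 j) = y j by exact/eqP/(xchooseP (yx j)).
have s0I : injective s0 by move=> i j ij; apply: yI; rewrite -!s0P ij.
exists (perm s0I) => j; rewrite permE s0P; split => //.
have /eqm : (size (1%:P * \prod_(k | k != s0 j) ('X - (x k)%:P))%R
    <= 2 * n)%N.
  by rewrite mul1r (leq_trans (szlag x (s0 j)))// mul2n -addnn leq_addr.
rewrite sum_node_poly hornerC mul1r.
under [RHS]eq_bigr do rewrite -s0P.
rewrite [X in _ = X -> _](bigD1 j)//= [X in _ + X]big1 ?addr0 => [|i ij];
  last first.
  rewrite mul1r horner_node_poly (bigD1 (s0 i))/= ?subrr ?mul0r ?mulr0//.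
  by apply: contra ij => /eqP/s0I ->.
rewrite mul1r horner_node_poly => /mulIf; apply; exact: lag0.
Qed.

(** Powers of the cosine are reached by induction on k, through the mixed
moments of cos^k t cos (m t) and the product formula
2 cos t cos (m t) = cos ((m + 1) t) + cos ((m - 1) t); this keeps k + m below N
and avoids writing the Chebyshev polynomials down. *)
Lemma cos_moments_pow (R : realType) (n N : nat) (t w u v : 'I_n -> R) :
  (forall m, (m < N)%N -> \sum_(i < n) w i * cos (m%:R * t i) =
                          \sum_(i < n) v i * cos (m%:R * u i)) ->
  forall k, (k < N)%N -> \sum_(i < n) w i * cos (t i) ^+ k =
                         \sum_(i < n) v i * cos (u i) ^+ k.
Proof.
move=> eqm k kN.
(* The case m = 0 of the mixed moments is the claim. *)
suff H m : (k + m < N)%N ->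
    \sum_(i < n) w i * (cos (t i) ^+ k * cos (m%:R * t i)) =
    \sum_(i < n) v i * (cos (u i) ^+ k * cos (m%:R * u i)).
  have := H 0%N; rewrite addn0 => /(_ kN).
  under eq_bigr do rewrite mul0r cos0 mulr1.
  by under [RHS]eq_bigr do rewrite mul0r cos0 mulr1.
elim: k m {kN} => [|k IH] m kmN.
  under eq_bigr do rewrite expr0 mul1r.
  by under [RHS]eq_bigr do rewrite expr0 mul1r; apply: eqm.
case: m kmN => [|m] kmN.
  have E (z : R) :
      cos z ^+ k.+1 * cos (0%:R * z) = cos z ^+ k * cos (1%:R * z).
    by rewrite mul0r cos0 mulr1 mul1r exprSr.
  under eq_bigr do rewrite E.
  under [RHS]eq_bigr do rewrite E.
  by apply: IH; rewrite addn1 -[k.+1]addn0.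
have E (c z : R) : c * (cos z ^+ k.+1 * cos (m.+1%:R * z)) =
    (c * (cos z ^+ k * cos (m.+2%:R * z)) +
     c * (cos z ^+ k * cos (m%:R * z))) / 2.
  have -> : m.+2%:R * z = m.+1%:R * z + z by rewrite -natr1 mulrDl mul1r.
  have -> : m%:R * z = m.+1%:R * z - z by rewrite -natr1 mulrDl mul1r addrK.
  by rewrite cosD cosB exprSr; field.
under eq_bigr do rewrite E.
under [RHS]eq_bigr do rewrite E.
have kmN2 : (k + m.+2 < N)%N by rewrite addnS -addSn.
have kmN0 : (k + m < N)%N.
  exact: leq_ltn_trans (leq_add (leqnSn k) (leqnSn m)) kmN.
by rewrite -!mulr_suml !big_split/= !IH.
Qed.

(** * Differential calculus on a segment *)

Section Affine.
Context {R : realType}.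
Implicit Types (w a x : R).

Lemma is_derive_affine w a x : is_derive x 1 (fun x => w * (x - a)) w.
Proof.
apply: trigger_derive.
by rewrite subr0 /GRing.scale/= mulr1.
Qed.

Lemma is_derive_cos_affine w a x :
  is_derive x 1 (fun x => cos (w * (x - a))) (- (w * sin (w * (x - a)))).
Proof.
rewrite mulrC -mulNr.
exact: (is_derive1_comp (is_derive_cos _) (is_derive_affine w a x)).
Qed.

Lemma is_derive_sin_affine w a x :
  is_derive x 1 (fun x => sin (w * (x - a))) (w * cos (w * (x - a))).
Proof.
rewrite mulrC.
exact: (is_derive1_comp (is_derive_sin _) (is_derive_affine w a x)).
Qed.

Lemma is_derive_continuous (f df : R -> R) :
  (forall x, is_derive x 1 f (df x)) -> continuous f.
Proof.
by move=> fdf x; apply/differentiable_continuous/derivable1_diffP; case: (fdf x).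
Qed.

Lemma continuous_cos_affine w a : continuous (fun x => cos (w * (x - a))).
Proof. exact: is_derive_continuous (is_derive_cos_affine w a). Qed.

Lemma continuous_sin_affine w a : continuous (fun x => sin (w * (x - a))).
Proof. exact: is_derive_continuous (is_derive_sin_affine w a). Qed.

Lemma within_continuousM (A : set R) (f g : R -> R) :
  {within A, continuous f} -> {within A, continuous g} ->
  {within A, continuous (fun x => f x * g x)}.
Proof. by move=> cf cg x; apply: cvgM; [exact: cf|exact: cg]. Qed.

Lemma derive0_itv_cst (a b : R) (g : R -> R) :
  {within `[a, b], continuous g} ->
  (forall x, x \in `]a, b[ -> is_derive x 1 g 0) ->
  forall x, x \in `[a, b] -> g x = g a.
Proof.
move=> cg dg x; rewrite in_itv/= => /andP[ax xb].
have [y _] : exists2 c, c \in `[a, x] & g x - g a = 0 * (x - a).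
  apply: (@MVT_segment _ _ (fun=> 0)) => // [y yax|].
    apply: dg; apply: subset_itv yax; rewrite ?bnd_simp//.
  by apply: continuous_subspaceW cg; apply: subset_itv; rewrite ?bnd_simp.
by rewrite mul0r => /eqP; rewrite subr_eq0 => /eqP.
Qed.

End Affine.

(** * The Neumann eigenvalue problem *)

Section Neumann.
Context {R : realType} (a b : R) (ab : a < b).

Let aab : a \in `[a, b]. Proof. by rewrite in_itv/= lexx ltW. Qed.
Let bab : b \in `[a, b]. Proof. by rewrite in_itv/= lexx ltW. Qed.
Let oocc x : x \in `]a, b[ -> x \in `[a, b].
Proof. by apply: subset_itv; rewrite bnd_simp. Qed.

(** The product g = f f' has derivative f'^2 - lam f^2 >= 0 and vanishes at both
endpoints, hence everywhere.  Then f^2 is constant, so f has no zero and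
f' = 0; the equation f'' = - lam f finally gives lam = 0. *)
Lemma neumann_eigenvalue_le0 lam f : neumann_eigenfunction a b lam f ->
  lam <= 0 -> lam = 0 /\ (f a != 0 /\ forall x, x \in `[a, b] -> f x = f a).
Proof.
move=> [[x0 x0ab fx0] [df [cf cdf dfdf dfa dfb]]] lam0.
pose g x := f x * df x.
have cg : {within `[a, b], continuous g} by exact: within_continuousM.
have dg x : x \in `]a, b[ -> is_derive x 1 g (df x ^+ 2 - lam * f x ^+ 2).
  move=> /dfdf[fx dfx]; apply: is_derive_eq (is_deriveM fx dfx) _.
  by rewrite /GRing.scale/=; ring.
have dg0 x : 0 <= df x ^+ 2 - lam * f x ^+ 2.
  by rewrite addr_ge0 ?sqr_ge0// oppr_ge0 mulr_le0_ge0 ?sqr_ge0.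
have gh : {in `[a, b] &, {homo g : x y / x <= y}}.
  apply: ger0_derive1_le_cc => // x xab; first by case: (dg x xab).
  by rewrite derive1E; case: (dg x xab) => _ ->.
have g0 x : x \in `[a, b] -> g x = 0.
  move=> xab; have := xab; rewrite in_itv/= => /andP[ax xb].
  apply/eqP; rewrite eq_le.
  have := gh _ _ xab bab xb; have := gh _ _ aab xab ax.
  by rewrite /g dfa dfb !mulr0 => -> ->.
have f2 x : x \in `[a, b] -> f x * f x = f a * f a.
  apply: (@derive0_itv_cst _ a b (fun x => f x * f x)).
    exact: within_continuousM.
  move=> y yab; have [fy _] := dfdf _ yab.
  apply: is_derive_eq (is_deriveM fy fy) _.
  by rewrite /GRing.scale/= -/(g y) g0 ?addr0//; exact: oocc.
have fn0 x : x \in `[a, b] -> f x != 0.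
  move=> xab; rewrite -sqrf_eq0 expr2 f2//.
  by rewrite -(f2 x0)// -expr2 sqrf_eq0.
have df0 x : x \in `[a, b] -> df x = 0.
  move=> xab; have /eqP := g0 _ xab.
  by rewrite mulf_eq0 (negbTE (fn0 _ xab))/= => /eqP.
split; last first.
  split; first exact: fn0.
  apply: derive0_itv_cst => // x xab; have [fx _] := dfdf _ xab.
  by apply: is_derive_eq fx _; apply: df0; exact: oocc.
have [c cab] := MVT ab (fun x xab => (dfdf x xab).2) cdf.
rewrite dfa dfb subrr => /esym/eqP.
rewrite mulf_eq0 subr_eq0 (gt_eqF ab) orbF mulf_eq0.
by rewrite (negbTE (fn0 _ (oocc cab))) orbF oppr_eq0 => /eqP.
Qed.

(** With C and S the cosine and sine of w (x - a), the functions w f C - f' S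
and w f S + f' C are constant by the differential equation, with values w f(a) and 0
at a.  Solving for f and f' gives f = f(a) C, and f'(b) = 0 becomes
sin (w (b - a)) = 0. *)
Lemma neumann_eigenvalue_gt0 w f : neumann_eigenfunction a b (w ^+ 2) f ->
  0 < w -> [/\ f a != 0, sin (w * (b - a)) = 0 &
    forall x, x \in `[a, b] -> f x = f a * cos (w * (x - a))].
Proof.
move=> [[x0 x0ab fx0] [df [cf cdf dfdf dfa dfb]]] w0.
have wn0 : w != 0 by rewrite gt_eqF.
pose C x := cos (w * (x - a)); pose S x := sin (w * (x - a)).
have cC : {within `[a, b], continuous C}.
  by apply: continuous_subspaceT; exact: continuous_cos_affine.
have cS : {within `[a, b], continuous S}.
  by apply: continuous_subspaceT; exact: continuous_sin_affine.
have Ca : C a = 1 by rewrite /C subrr mulr0 cos0.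
have Sa : S a = 0 by rewrite /S subrr mulr0 sin0.
have CS x : C x ^+ 2 + S x ^+ 2 = 1 by exact: cos2Dsin2.
pose g x := w * f x * C x - df x * S x.
pose h x := w * f x * S x + df x * C x.
have cwf : {within `[a, b], continuous (fun x => w * f x)}.
  by apply: within_continuousM => // x; exact: cvg_cst.
have gE x : x \in `[a, b] -> g x = g a.
  apply: derive0_itv_cst.
    by apply: within_continuousB; exact: within_continuousM.
  move=> y /dfdf[fy dfy].
  have dC := is_derive_cos_affine w a y; have dS := is_derive_sin_affine w a y.
  apply: is_derive_eq (is_deriveB
    (is_deriveM (is_deriveM (is_derive_cst w y 1) fy) dC) (is_deriveM dfy dS)) _.
  by rewrite -[(_ * f) y]/(w * f y) /GRing.scale/=; ring.
have hE x : x \in `[a, b] -> h x = h a.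
  apply: derive0_itv_cst.
    by apply: within_continuousD; exact: within_continuousM.
  move=> y /dfdf[fy dfy].
  have dC := is_derive_cos_affine w a y; have dS := is_derive_sin_affine w a y.
  apply: is_derive_eq (is_deriveD
    (is_deriveM (is_deriveM (is_derive_cst w y 1) fy) dS) (is_deriveM dfy dC)) _.
  by rewrite -[(_ * f) y]/(w * f y) /GRing.scale/=; ring.
have ha : h a = 0 by rewrite /h dfa Sa mulr0 mul0r addr0.
have ga : g a = w * f a by rewrite /g dfa Ca mul0r subr0 mulr1.
have fE x : x \in `[a, b] -> f x = f a * C x.
  move=> xab; apply: (mulfI wn0); rewrite mulrA -ga -(gE _ xab).
  have : h x * S x = 0 by rewrite hE// ha mul0r.
  rewrite /g /h => hS.
  transitivity (w * f x * (C x ^+ 2 + S x ^+ 2)); first by rewrite CS mulr1.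
  by rewrite -[RHS]addr0 -hS; ring.
have fa : f a != 0.
  by apply: contra fx0 => /eqP fa; rewrite fE// fa mul0r.
split => //.
(* A nonzero sine would force f(b) = 0 besides f'(b) = 0, hence g b = 0, which
   contradicts g b = w f(a). *)
have : h b = 0 by rewrite hE.
rewrite /h dfb mul0r addr0 => /eqP.
rewrite !mulf_eq0 (negbTE wn0)/= => /orP[/eqP fb0|/eqP//].
have := gE _ bab; rewrite ga /g fb0 dfb mulr0 !mul0r subr0 => /esym/eqP.
by rewrite mulf_eq0 (negbTE wn0) (negbTE fa).
Qed.

End Neumann.

(** * Integrals against the uniform probability *)

Section UniformIntegral.
Context {R : realType} (a b : R) (ab : a < b).
Local Notation mu := (@lebesgue_measure R).

(** For nonnegative functions this is the density of the uniform law; the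
positive and negative parts of f are treated separately, and recombined thanks to the
integrability of f on [a, b]. *)
Lemma integral_uniform_continuous (f : R -> R) : continuous f ->
  (\int[uniform_prob ab]_(x in `[a, b]) (f x)%:E =
   (b - a)^-1%:E * \int[mu]_(x in `[a, b]) (f x)%:E)%E.
Proof.
move=> cf.
have mf : measurable_fun setT (EFin \o f).
  by apply/measurable_EFinP; exact: continuous_measurable_fun.
have fint : mu.-integrable `[a, b] (EFin \o f).
  apply: continuous_compact_integrable; first exact: segment_compact.
  exact: continuous_subspaceT.
have part (g : _ -> \bar R) : measurable_fun setT g -> (forall x, 0 <= g x)%E ->
    (\int[uniform_prob ab]_(x in `[a, b]) g x =
     (b - a)^-1%:E * \int[mu]_(x in `[a, b]) g x)%E.
  move=> mg g0; rewrite integral_mkcond integral_uniform; last 2 first.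
    by apply/(measurable_restrictT _ _).1 => //; exact: measurable_funTS.
    by move=> x; rewrite patchE; case: ifPn.
  by congr (_ * _)%E; rewrite -integral_mkcondr setIid.
rewrite integralE [in RHS]integralE muleBr//; last first.
  by rewrite fin_num_adde_defr// integrable_pos_fin_num.
by rewrite !part//; [exact: measurable_funeneg|exact: measurable_funepos].
Qed.

Lemma integral_uniform_FTC (f F : R -> R) : continuous f ->
  (forall x : R, is_derive x 1 F (f x)) ->
  (\int[uniform_prob ab]_(x in `[a, b]) (f x)%:E =
   ((F b - F a) / (b - a))%:E)%E.
Proof.
move=> cf dF; rewrite integral_uniform_continuous//.
have cF : continuous F.
  by move=> x; apply/differentiable_continuous/derivable1_diffP; case: (dF x).
rewrite (@continuous_FTC2 _ f F)//.
- by rewrite -EFinB -EFinM mulrC.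
- exact: continuous_subspaceT.
- split => [x _||]; first by case: (dF x).
  + by apply: cvg_at_right_filter; exact: cF.
  + by apply: cvg_at_left_filter; exact: cF.
- by move=> x _; rewrite derive1E; case: (dF x).
Qed.

End UniformIntegral.

(** * Poincare bases *)

(** Identifies the ranks of the eigenvalues: an increasing enumeration of all of
them cannot skip any. *)
Lemma incr_surj_nat (k : nat -> nat) : {homo k : i j / (i < j)%N} ->
  (forall m, exists i, k i = m) -> k =1 id.
Proof.
move=> kh ks.
have kge i : (i <= k i)%N.
  by elim: i => // i IH; apply: leq_ltn_trans IH (kh _ _ (ltnSn i)).
elim/ltn_ind => m IH; have [j kj] := ks m.
have := kge j; rewrite kj leq_eqVlt => /predU1P[jm|jm].
  by rewrite -[in LHS]jm.
by move: kj; rewrite IH// => jE; rewrite jE ltnn in jm.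
Qed.

Section CosineFamily.
Context {R : realType} (a b : R) (ab : a < b).

Let L0 : b - a != 0. Proof. by rewrite subr_eq0 gt_eqF. Qed.
Let pi0 : (pi : R) != 0. Proof. by rewrite gt_eqF ?pi_gt0. Qed.
Let aab : a \in `[a, b]. Proof. by rewrite in_itv/= lexx ltW. Qed.

Definition neumann_freq (m : nat) : R := m%:R * pi / (b - a).

Lemma neumann_freqE m x :
  m%:R * pi * ((x - a) / (b - a)) = neumann_freq m * (x - a).
Proof. by rewrite /neumann_freq; field. Qed.

Definition neumann_cos (m : nat) (x : R) : R :=
  cos (neumann_freq m * (x - a)).

Lemma neumann_freq_gt0 m : (0 < m)%N -> 0 < neumann_freq m.
Proof. by move=> m0; rewrite divr_gt0 ?subr_gt0// mulr_gt0 ?pi_gt0 ?ltr0n. Qed.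

Lemma neumann_freq0 : neumann_freq 0 = 0.
Proof. by rewrite /neumann_freq !mul0r. Qed.

Lemma neumann_freq_lt i j : (i < j)%N ->
  neumann_freq i ^+ 2 < neumann_freq j ^+ 2.
Proof.
move=> ij; rewrite ltr_pXn2r// ?nnegrE.
- by rewrite ltr_pM2r ?invr_gt0 ?subr_gt0// ltr_pM2r ?pi_gt0// ltr_nat.
- case: i {ij} => [|i]; first by rewrite neumann_freq0.
  exact/ltW/neumann_freq_gt0.
- by apply/ltW/neumann_freq_gt0; case: j ij.
Qed.

Lemma neumann_freq_inj : injective (fun m => neumann_freq m ^+ 2).
Proof.
move=> i j /= /eqP; apply: contraTeq; rewrite neq_ltn => /orP[] /neumann_freq_lt.
  by move/lt_eqF ->.
by move/gt_eqF ->.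
Qed.

Lemma neumann_cos_eigenfunction c m : c != 0 ->
  neumann_eigenfunction a b (neumann_freq m ^+ 2)
    (fun x => c * neumann_cos m x).
Proof.
move=> c0; set w := neumann_freq m; split.
  by exists a; rewrite // /neumann_cos subrr mulr0 cos0 mulr1.
have dcos (x : R) : is_derive x 1 (fun x => c * neumann_cos m x)
    (- (c * w) * sin (w * (x - a))).
  apply: is_derive_eq
    (is_deriveM (is_derive_cst c x 1) (is_derive_cos_affine w a x)) _.
  by rewrite /GRing.scale/= /cst; ring.
have dsin (x : R) : is_derive x 1 (fun x => - (c * w) * sin (w * (x - a)))
    (- (w ^+ 2) * (c * neumann_cos m x)).
  apply: is_derive_eq
    (is_deriveM (is_derive_cst (- (c * w)) x 1) (is_derive_sin_affine w a x)) _.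
  by rewrite /GRing.scale/= /cst /neumann_cos -/w; ring.
exists (fun x => - (c * w) * sin (w * (x - a))); split => //.
- by apply: continuous_subspaceT; exact: is_derive_continuous dcos.
- by apply: continuous_subspaceT; exact: is_derive_continuous dsin.
- by rewrite subrr mulr0 sin0 mulr0.
- by rewrite /w /neumann_freq divfK// sin_nat_pi mulr0.
Qed.

Lemma neumann_eigenfunctionP lam f : neumann_eigenfunction a b lam f ->
  exists m, lam = neumann_freq m ^+ 2 /\
    exists2 c, c != 0 & forall x, x \in `[a, b] -> f x = c * neumann_cos m x.
Proof.
move=> fe; have [lam0|lam0] := leP lam 0.
  have [-> [fa fE]] := neumann_eigenvalue_le0 ab fe lam0.
  exists 0%N; rewrite neumann_freq0 expr0n; split => //.
  exists (f a) => // x /fE ->.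
  by rewrite /neumann_cos neumann_freq0 mul0r cos0 mulr1.
have w0 : 0 < Num.sqrt lam by rewrite sqrtr_gt0.
rewrite -(sqr_sqrtr (ltW lam0)) in fe *.
have [fa sb fE] := neumann_eigenvalue_gt0 ab fe w0.
have [|m mE] := sin_eq0_nat _ sb.
  by rewrite mulr_ge0 ?subr_ge0 ?(ltW ab) ?ltW.
have wE : Num.sqrt lam = neumann_freq m by rewrite /neumann_freq -mE mulfK.
by rewrite wE in fE *; exists m; split => //; exists (f a).
Qed.

Lemma integral_neumann_cos c m :
  (\int[uniform_prob ab]_(x in `[a, b]) (c * neumann_cos m x)%:E =
   (c * (m == 0%N)%:R)%:E)%E.
Proof.
set w := neumann_freq m.
have cc : continuous (fun x => c * neumann_cos m x).
  by move=> x; apply: cvgM; [exact: cvg_cst|exact: continuous_cos_affine].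
case: (posnP m) => [m0|m0].
  have dF (x : R) : is_derive x 1 (fun x => c * (x - a)) (c * neumann_cos m x).
    apply: is_derive_eq (is_derive_affine c a x) _.
    by rewrite /neumann_cos m0 neumann_freq0 mul0r cos0 mulr1.
  rewrite (integral_uniform_FTC ab cc dF).
  by rewrite subrr mulr0 subr0 mulfK// mulr1.
have w0 : w != 0 by rewrite gt_eqF// neumann_freq_gt0.
have dF (x : R) : is_derive x 1 (fun x => c / w * sin (w * (x - a)))
    (c * neumann_cos m x).
  apply: is_derive_eq
    (is_deriveM (is_derive_cst (c / w) x 1) (is_derive_sin_affine w a x)) _.
  by rewrite /GRing.scale/= /cst mulr0 addr0 mulrA divfK.
rewrite (integral_uniform_FTC ab cc dF).
rewrite subrr mulr0 sin0 mulr0 subr0 {2}/w /neumann_freq divfK// sin_nat_pi.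
by rewrite mulr0 mul0r mulr0.
Qed.

Lemma cosine_basisE m x : cosine_basis a b m x =
  (if m == 0%N then 1 else Num.sqrt 2) * neumann_cos m x.
Proof.
rewrite /cosine_basis neumann_freqE /neumann_cos; case: eqP => // ->.
by rewrite neumann_freq0 mul0r cos0 mulr1.
Qed.

(** The linearization 2 cos^2 t = 1 + cos (2 t), arranged to cover the constant
function m = 0 as well. *)
Lemma sqr_cosine_basis m x : cosine_basis a b m x ^+ 2 =
  1 + (if m == 0%N then 0 else 1) * neumann_cos (2 * m) x.
Proof.
rewrite /cosine_basis neumann_freqE /neumann_cos; case: eqP => _.
  by rewrite expr1n mul0r addr0.
rewrite exprMn sqr_sqrtr// mul1r.
have -> : neumann_freq (2 * m) * (x - a) = (neumann_freq m * (x - a)) *+ 2.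
  by rewrite /neumann_freq natrM; ring.
by rewrite cos_mulr2n; ring.
Qed.

Lemma cosine_basis_normalized m :
  (\int[uniform_prob ab]_(x in `[a, b]) (cosine_basis a b m x ^+ 2)%:E = 1)%E.
Proof.
pose c : R := if m == 0%N then 0 else 1.
pose w := neumann_freq (2 * m).
(* For m = 0 both c and w vanish, and the convention c / w = 0 still gives a
   primitive. *)
have dF (x : R) :
  is_derive x 1 (fun x => 1 * (x - a) + c / w * sin (w * (x - a)))
    (cosine_basis a b m x ^+ 2).
  apply: is_derive_eq (is_deriveD (is_derive_affine 1 a x)
    (is_deriveM (is_derive_cst (c / w) x 1) (is_derive_sin_affine w a x))) _.
  rewrite /GRing.scale/= /cst mulr0 addr0 mulrA sqr_cosine_basis -/c.
  congr (_ + _ * _).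
  rewrite /c; case: posnP => m0; first by rewrite !mul0r.
  by rewrite divfK// gt_eqF// neumann_freq_gt0// muln_gt0.
have cc : continuous (fun x => cosine_basis a b m x ^+ 2).
  rewrite (_ : (fun x => _) = fun x => 1 + c * neumann_cos (2 * m) x); last first.
    by apply/funext => x; exact: sqr_cosine_basis.
  move=> x; apply: cvgD; first exact: cvg_cst.
  by apply: cvgM; [exact: cvg_cst|exact: continuous_cos_affine].
rewrite (integral_uniform_FTC ab cc dF).
rewrite !subrr !mulr0 sin0 mulr0 addr0 subr0 {2}/w /neumann_freq divfK//.
by rewrite sin_nat_pi mulr0 addr0 mul1r divff.
Qed.

Lemma poincare_cosine_basis : poincare_basis ab (cosine_basis a b).
Proof.
exists (fun m => neumann_freq m ^+ 2); split.
- exact: neumann_freq_lt.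
- move=> m; rewrite (_ : cosine_basis a b m = fun x =>
    (if m == 0%N then 1 else Num.sqrt 2) * neumann_cos m x); last first.
    by apply/funext => x; exact: cosine_basisE.
  apply: neumann_cos_eigenfunction; case: ifP => _; first exact: oner_neq0.
  by rewrite sqrtr_eq0 -ltNge ltr0n.
- by move=> l f /neumann_eigenfunctionP[m [-> _]]; exists m.
- exact: cosine_basis_normalized.
Qed.

(** The m-th eigenvalue is the square of the k m-th frequency for some k m; as
both sequences are increasing and exhaust the same set, k is the identity. *)
Lemma poincare_basis_cos phi : poincare_basis ab phi ->
  forall m, exists2 c, c != 0 &
    forall x, x \in `[a, b] -> phi m x = c * neumann_cos m x.
Proof.
move=> [lam [lamlt phiE lamS _]].
have /choice[k kE] : forall m, exists k, lam m = neumann_freq k ^+ 2.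
  by move=> m; have [k [-> _]] := neumann_eigenfunctionP (phiE m); exists k.
have kid : k =1 id.
  apply: incr_surj_nat => [i j|m].
    move=> /lamlt; rewrite !kE; apply: contraTT; rewrite -leqNgt -leNgt.
    by rewrite leq_eqVlt => /predU1P[->//|/neumann_freq_lt/ltW].
  have [j jE] := lamS _ _ (neumann_cos_eigenfunction m (oner_neq0 R)).
  by exists j; apply: neumann_freq_inj; rewrite -kE.
move=> m; have [j [+ cE]] := neumann_eigenfunctionP (phiE m).
by rewrite kE => /neumann_freq_inj jE; rewrite -jE kid in cE.
Qed.

(** The variable t in which the m-th basis function is proportional to
cos (m t); it maps [a, b] onto [0, pi], where the cosine is injective. *)
Definition neumann_angle (x : R) : R := pi * ((x - a) / (b - a)).

Lemma neumann_cosE m x : neumann_cos m x = cos (m%:R * neumann_angle x).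
Proof. by rewrite /neumann_angle mulrA neumann_freqE. Qed.

Lemma neumann_angle_itv x : x \in `[a, b] -> neumann_angle x \in `[0, pi].
Proof.
rewrite !in_itv/= => /andP[ax xb].
have L : 0 < b - a by rewrite subr_gt0.
rewrite mulr_ge0 ?pi_ge0 ?divr_ge0 ?subr_ge0 ?(ltW ab)//=.
by rewrite ler_piMr ?pi_ge0// ler_pdivrMr// mul1r lerD2r.
Qed.

Lemma neumann_angle_inj : injective neumann_angle.
Proof.
by move=> x y /(mulfI pi0)/(mulIf (invr_neq0 L0))/addIr.
Qed.

(** A common nonzero factor cancels on both sides, which is why all the Poincare
bases have the same exact quadratures. *)
Lemma quad_exact_cos n (x w : 'I_n -> R) m c f : c != 0 ->
  (forall i, x i \in `[a, b]) ->
  (forall t, t \in `[a, b] -> f t = c * neumann_cos m t) ->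
  quad_exact ab x w f <->
  \sum_(i < n) w i * cos (m%:R * neumann_angle (x i)) = (m == 0%N)%:R.
Proof.
move=> c0 xab fE; rewrite /quad_exact /quad.
have -> : (\int[uniform_prob ab]_(t in `[a, b]) (f t)%:E =
    (c * (m == 0%N)%:R)%:E)%E.
  rewrite -integral_neumann_cos; apply: eq_integral => t.
  by rewrite inE/= => /fE ->.
have -> : \sum_(i < n) w i * f (x i) =
    c * \sum_(i < n) w i * cos (m%:R * neumann_angle (x i)).
  by rewrite mulr_sumr; apply: eq_bigr => i _; rewrite fE// neumann_cosE mulrCA.
by split => [[/(mulfI c0)]|->].
Qed.

End CosineFamily.

(** * The midpoint rule *)

Section Midpoint.
Context {R : realType} (a b : R) (ab : a < b) (n : nat) (n0 : (0 < n)%N).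
Local Notation node := (@midpoint_node R a b n).
Let h := (b - a) / n%:R.

Let L0 : 0 < b - a. Proof. by rewrite subr_gt0. Qed.
Let nR0 : n%:R != 0 :> R. Proof. by rewrite pnatr_eq0 -lt0n. Qed.
Let h0 : 0 < h. Proof. by rewrite divr_gt0// ltr0n. Qed.

Lemma midpoint_node_inj : injective node.
Proof.
move=> i j /addrI/(mulIf (lt0r_neq0 h0))/addIr/eqP.
by rewrite eqr_nat eqSS => /eqP/val_inj.
Qed.

Lemma midpoint_nodeE i : node i = ((a + i%:R * h) + (a + i.+1%:R * h)) / 2.
Proof. by rewrite /midpoint_node -/h -natr1; field. Qed.

Lemma midpoint_node_itv i : node i \in `[a, b].
Proof.
have i0 : 0 <= (i : nat)%:R :> R by [].
have i1 : (i.+1)%:R <= n%:R :> R by rewrite ler_nat.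
have bE : b = a + n%:R * h by rewrite /h mulrC divfK// addrC subrK.
rewrite in_itv/= /midpoint_node -/h; apply/andP; split.
  by rewrite lerDl mulr_ge0 ?(ltW h0)// -natr1; lra.
by rewrite [leRHS]bE lerD2l ler_wpM2r ?(ltW h0)//; lra.
Qed.

Lemma midpoint_node_angle i :
  neumann_angle a b (node i) = pi * ((i.+1%:R - 2^-1) / n%:R).
Proof.
rewrite /neumann_angle /midpoint_node; field.
by rewrite nR0 gt_eqF.
Qed.

Lemma midpoint_cos_moment m : m = 0%N \/ ~~ (2 * n %| m)%N ->
  \sum_(i < n) 1 / n%:R * cos (m%:R * neumann_angle a b (node i)) =
  (m == 0%N)%:R.
Proof.
case=> [->|mn]; rewrite -mulr_sumr.
  under eq_bigr do rewrite mul0r cos0.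
  by rewrite sumr_const card_ord mul1r mulVf.
have m0 : m != 0%N by apply: contraNneq mn => ->; rewrite dvdn0.
under eq_bigr do rewrite midpoint_node_angle mulrA.
by rewrite sum_cos_midpoints// mulr0 (negbTE m0).
Qed.

Lemma midpoint_exact_poly1 (p : {poly R}) : (size p <= 2)%N ->
  quad_exact ab node (fun=> 1 / n%:R) (fun x => p.[x]).
Proof.
move=> p2; have pE x : p.[x] = p`_0 + p`_1 * x.
  rewrite (horner_coef_wide _ p2) !big_ord_recl big_ord0.
  by rewrite expr0 mulr1 addr0 expr1.
have dF (x : R) : is_derive x 1 (fun x => p`_0 * x + p`_1 / 2 * (x * x)) p.[x].
  apply: is_derive_eq (is_deriveD (is_deriveM (is_derive_cst p`_0 x 1)
    (is_derive_id x 1)) (is_deriveM (is_derive_cst (p`_1 / 2) x 1)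
    (is_deriveM (is_derive_id x 1) (is_derive_id x 1)))) _.
  by rewrite pE /GRing.scale/= /cst; field.
rewrite /quad_exact (integral_uniform_FTC ab (@continuous_horner _ p) dF) /quad.
have sum_half k : \sum_(i < k) (i.+1%:R - 2^-1) = k%:R ^+ 2 / 2 :> R.
  elim: k => [|k IH]; first by rewrite big_ord0 expr0n mul0r.
  by rewrite big_ord_recr/= IH -natr1; field.
have -> : \sum_(i < n) 1 / n%:R * p.[node i] =
    \sum_(i < n) 1 / n%:R * (p`_0 + p`_1 * a) +
    1 / n%:R * p`_1 * h * \sum_(i < n) (i.+1%:R - 2^-1).
  rewrite mulr_sumr -big_split/=; apply: eq_bigr => i _.
  by rewrite pE /midpoint_node -/h; ring.
congr (_%:E).
rewrite sum_half sumr_const card_ord -mulr_natr /h; field.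
by rewrite nR0 gt_eqF.
Qed.

End Midpoint.

Theorem proposition11 (R : realType) (a b : R) (ab : a < b)
    (n : nat) (n_ge1 : (1 <= n)%N) :
  poincare_basis ab (cosine_basis a b) /\
  forall phi : nat -> R -> R, poincare_basis ab phi ->
    let node : 'I_n -> R := @midpoint_node R a b n in
    let weight : 'I_n -> R := fun=> 1 / n%:R in
    let h := (b - a) / n%:R in
    (* the midpoint rule is the unique Poincare quadrature with n nodes *)
    (poincare_quadrature ab phi node weight /\
     (forall x w : 'I_n -> R, poincare_quadrature ab phi x w ->
        (exists s : {perm 'I_n},
           forall i, x (s i) = node i /\ w (s i) = weight i) /\
        (forall f : R -> R, (b - a) * quad x w f = midpoint_rule a b n f))) /\
    (* the nodes are evenly spaced and are the midpoints of the cells *)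
    ((forall i j : 'I_n, j = i.+1 :> nat -> node j - node i = h) /\
     (forall i : 'I_n,
        node i = ((a + i%:R * h) + (a + i.+1%:R * h)) / 2)) /\
    (* exactness *)
    ((forall m : nat, (m <= (2 * n).-1)%N ->
        quad_exact ab node weight (phi m)) /\
     (forall m : nat, ~~ (2 * n %| m)%N ->
        quad_exact ab node weight (phi m)) /\
     (forall p : {poly R}, (size p <= 2)%N ->
        quad_exact ab node weight (fun x => p.[x]))).
Proof.
have n0 : (0 < n)%N by [].
split; first exact: poincare_cosine_basis.
move=> phi /poincare_basis_cos phiE node weight h.
have nab i : node i \in `[a, b] by exact: midpoint_node_itv.
have ltn2n m : (m <= (2 * n).-1)%N = (m < 2 * n)%N.
  by rewrite -ltnS prednK// muln_gt0.
have low m : (m <= (2 * n).-1)%N -> m = 0%N \/ ~~ (2 * n %| m)%N.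
  case: m => [|m]; first by left.
  by move=> mn; right; rewrite gtnNdvd// -ltn2n.
have phi_exact m : m = 0%N \/ ~~ (2 * n %| m)%N ->
    quad_exact ab node weight (phi m).
  move=> mP; have [c c0 cE] := phiE m.
  exact/(quad_exact_cos _ _ c0 nab cE)/midpoint_cos_moment.
split; last first.
  split.
    split => [i j ij|i]; last exact: midpoint_nodeE.
    by rewrite /node /midpoint_node ij -[i.+2%:R]natr1 -/h; ring.
  split; first by move=> m /low/phi_exact.
  split; first by move=> m mn; apply: phi_exact; right.
  exact: midpoint_exact_poly1.
split.
  split => //; first exact: midpoint_node_inj.
    by move=> i; rewrite divr_gt0// ltr0n.
  by move=> m /low/phi_exact.
move=> x w [xI xab w0 xex].
have [s sP] : exists s : {perm 'I_n},
    forall i, x (s i) = node i /\ w (s i) = weight i.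
  have angI (z : 'I_n -> R) : injective z -> (forall i, z i \in `[a, b]) ->
      injective (fun i => cos (neumann_angle a b (z i))).
    move=> zI zab i j /cos_inj zij; apply/zI/(neumann_angle_inj ab)/zij;
      exact: neumann_angle_itv.
  have [||||s sP] := @gauss_unique _ n (fun i => cos (neumann_angle a b (x i))) w
    (fun i => cos (neumann_angle a b (node i))) weight.
  - exact: angI.
  - by apply: angI => //; exact: midpoint_node_inj.
  - by move=> i; rewrite /weight div1r invr_eq0 pnatr_eq0 -lt0n.
  - apply: cos_moments_pow => m mn.
    have mn1 : (m <= (2 * n).-1)%N by rewrite ltn2n.
    have [c c0 cE] := phiE m.
    have /(quad_exact_cos _ _ c0 xab cE) -> := xex _ mn1.
    by have /(quad_exact_cos _ _ c0 nab cE) -> := phi_exact _ (low _ mn1).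
  exists s => i; have [xs ws] := sP i; split => //.
  apply: (neumann_angle_inj ab).
  by apply: cos_inj xs; exact: neumann_angle_itv.
split; first by exists s.
move=> f; rewrite /quad (reindex_inj (@perm_inj _ s))/= /midpoint_rule.
rewrite (eq_bigr (fun i => 1 / n%:R * f (node i))) => [|i _].
  by rewrite -mulr_sumr mulrA mul1r.
by have [-> ->] := sP i.
Qed.
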